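(* Let $K\ge 1$, let $n=n_1+\cdots+n_K$ with positive integers $n_i$, and let $\theta=(\theta^{(1)},\dots,\theta^{(K)})\in\mathbb{R}^n$ with blocks $\theta^{(i)}\in\mathbb{R}^{n_i}$ have strictly positive components. Let $$\Omega=(1-\rho)\,\mathrm{Diag}(\Omega_1,\dots,\Omega_K)+\rho\,\mathbf{1}\mathbf{1}^{\mathsf T}\in\mathbb{R}^{n\times n},\qquad \Omega_i=(1-\rho_i)I_i+\rho_i\,\mathbf{1}_i\mathbf{1}_i^{\mathsf T}\in\mathbb{R}^{n_i\times n_i},$$ where $\rho_i\in\left(-\frac{1}{n_i-1},1\right)$ for $i=1,\dots,K$ and $$-\left(\sum_{i=1}^K\frac{n_i}{1+(n_i-1)\rho_i}-1\right)^{-1}<\rho<1.$$ Then the solution $y=(y^{(1)},\dots,y^{(K)})$, with $y^{(i)}\in\mathbb{R}^{n_i}$, to $$\min_{y\in\mathbb{R}^n}\ \tfrac12\,y^{\mathsf T}\Omega y-\theta^{\mathsf T}y\quad\text{s.t. } y\ge 0$$ is given for each block $i=1,\dots,K$ by $$y^{(i)}=\frac{1}{(1-\rho)(1-\rho_i)}\left(\theta^{(i)}-(\hat\theta+\bar\theta_i)\mathbf{1}_i\right)^+,$$ where the thresholds $\bar\theta_1,\dots,\bar\theta_K\in\mathbb{R}$ and $\hat\theta\in\mathbb{R}$ are the solution to the fixed-point problem $$\bar\theta_i=\frac{\rho_i}{1-\rho_i}\,\mathbf{1}_i^{\mathsf T}\left(\theta^{(i)}-(\hat\theta+\bar\theta_i)\mathbf{1}_i\right)^+,\qquad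 i=1,\dots,K,$$ $$\hat\theta=\frac{\rho}{1-\rho}\sum_{j=1}^K\frac{1}{1-\rho_j}\,\mathbf{1}_j^{\mathsf T}\left(\theta^{(j)}-(\hat\theta+\bar\theta_j)\mathbf{1}_j\right)^+.$$
   Context: $\mathbf{1}\in\mathbb{R}^n$ and $\mathbf{1}_i\in\mathbb{R}^{n_i}$ are vectors of all ones, $I_i$ is the $n_i\times n_i$ identity, and $\mathrm{Diag}(\Omega_1,\dots,\Omega_K)$ is the block-diagonal matrix with the indicated diagonal blocks. For a vector $v$, $v^+$ denotes the componentwise positive part. Vector inequalities are componentwise. In the paper $\theta$ is the vector of reciprocals of the strictly positive asset volatilities. In the parameter ranges, an expression of the form $-1/0$ (arising when $n_i=1$, or when $K=1$ and $n_1=1$) is read as $-\infty$. *)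

(* Defs.v *)
From HB Require Import structures.
From mathcomp Require Import all_boot all_order all_algebra.
From mathcomp Require Import all_classical all_reals.

Set Implicit Arguments.
Unset Strict Implicit.
Unset Printing Implicit Defensive.

Import Order.TTheory GRing.Theory Num.Theory.

Local Open Scope ring_scope.

Definition ones {R : realType} (m : nat) : 'cV[R]_m := const_mx 1.

Definition pospart {R : realType} m (v : 'cV[R]_m) : 'cV[R]_m :=
  map_mx (fun x => Num.max x 0) v.

Definition unit_corr {R : realType} (m : nat) (r : R) : 'M[R]_m :=
  (1 - r) *: 1%:M + r *: (ones m *m (ones m)^T).

Definition block_corr {R : realType} (K : nat) (n_ : 'I_K -> nat)
    (rho_ : 'I_K -> R) (rho : R) : 'M[R]_(\sum_i n_ i) :=
  (1 - rho) *: (\mxdiag_i unit_corr (n_ i) (rho_ i))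
  + rho *: (ones (\sum_i n_ i) *m (ones (\sum_i n_ i))^T).

(* In [\bar R] the inverse of [0] is [+oo], so both lower bounds below are
   [-oo] when the real number being inverted is zero. For [n_ i >= 1] and
   [rho_ i] in its range, each summand in [rho_range] is at least 1, hence the
   inverted number is nonnegative. *)
Definition rho_block_range {R : realType} (K : nat) (n_ : 'I_K -> nat)
    (rho_ : 'I_K -> R) : Prop :=
  forall i, (- ((n_ i)%:R - 1)%:E^-1 < (rho_ i)%:E)%E /\ rho_ i < 1.

Definition rho_range {R : realType} (K : nat) (n_ : 'I_K -> nat)
    (rho_ : 'I_K -> R) (rho : R) : Prop :=
  (- (\sum_i (n_ i)%:R / (1 + ((n_ i)%:R - 1) * rho_ i) - 1)%:E^-1
     < rho%:E)%E /\ rho < 1.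

Definition quad_obj {R : realType} m (Q : 'M[R]_m) (c y : 'cV[R]_m) : R :=
  2^-1 * (y^T *m Q *m y) 0 0 - (c^T *m y) 0 0.

Definition feasible {R : realType} m (y : 'cV[R]_m) : Prop :=
  forall k, 0 <= y k 0.

Definition qp_solution {R : realType} m (Q : 'M[R]_m) (c y : 'cV[R]_m) : Prop :=
  feasible y /\ forall z, feasible z -> quad_obj Q c y <= quad_obj Q c z.

Section Thresholds.
Context {R : realType} (K : nat) (n_ : 'I_K -> nat).
Variables (rho_ : 'I_K -> R) (rho : R) (theta : 'cV[R]_(\sum_i n_ i)).

Definition excess (hat_t : R) (bar_t : 'cV[R]_K) (i : 'I_K) : 'cV[R]_(n_ i) :=
  pospart (submxcol theta i - (hat_t + bar_t i 0) *: ones (n_ i)).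

Definition total_excess (hat_t : R) (bar_t : 'cV[R]_K) (i : 'I_K) : R :=
  ((ones (n_ i))^T *m excess hat_t bar_t i) 0 0.

Definition threshold_fixpoint (hat_t : R) (bar_t : 'cV[R]_K) : Prop :=
  (forall i, bar_t i 0 = rho_ i / (1 - rho_ i) * total_excess hat_t bar_t i)
  /\ hat_t = rho / (1 - rho)
             * \sum_j (1 - rho_ j)^-1 * total_excess hat_t bar_t j.

End Thresholds.

(* Main.v *)
Require Import Defs.
From HB Require Import structures.
From mathcomp Require Import all_boot all_order all_algebra.
From mathcomp Require Import all_classical all_reals.
From mathcomp Require Import topology normedtype derive.
From mathcomp Require Import ring lra.

Set Implicit Arguments.
Unset Strict Implicit.
Unset Printing Implicit Defensive.

Import Order.TTheory GRing.Theory Num.Theory numFieldNormedType.Exports.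

Local Open Scope ring_scope.

(* The matrix [Omega] is coercive: with [s_i] the sum of the [i]-th block of [x],
   [B_i] its quadratic form under [Omega_i] and [N] the sum of the
   [n_i / (1 + (n_i - 1) rho_i)], Cauchy-Schwarz gives
   [s_i^2 <= n_i / (1 + (n_i - 1) rho_i) * B_i], hence
   [(sum s)^2 <= N * sum B], so that
   [x^T Omega x = (1 - rho) sum B + rho (sum s)^2] is at least a positive
   multiple of [sum B]. The quadratic program therefore has exactly one
   solution, characterised by its KKT conditions. Since
   [(Omega y)^(i) = (1 - rho) (1 - rho_i) y^(i) + (hat + bar_i) 1] with
   [hat = rho * sum_j s_j] and [bar_i = (1 - rho) rho_i s_i], the KKT conditions
   say coordinatewise that [y] is the thresholding of [theta] at its own
   [hat + bar_i], and the fixed-point equations say precisely that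
   [(hat, bar)] are the thresholds computed from the [y] they define. *)

(** * Euclidean inner product on column vectors *)

Definition dot {R : realType} m (u v : 'cV[R]_m) : R := (u^T *m v) 0 0.

Section Dot.
Context {R : realType} (m : nat).
Implicit Types u v w : 'cV[R]_m.

Lemma dotE u v : dot u v = \sum_k u k 0 * v k 0.
Proof. by rewrite /dot mxE; apply: eq_bigr => k _; rewrite mxE. Qed.

Lemma dotC u v : dot u v = dot v u.
Proof. by rewrite !dotE; apply: eq_bigr => k _; rewrite mulrC. Qed.

Lemma dotDr u v w : dot u (v + w) = dot u v + dot u w.
Proof. by rewrite /dot mulmxDr mxE. Qed.

Lemma dotDl u v w : dot (u + v) w = dot u w + dot v w.
Proof. by rewrite dotC dotDr !(dotC w). Qed.

Lemma dotZr u a v : dot u (a *: v) = a * dot u v.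
Proof. by rewrite /dot -scalemxAr mxE. Qed.

Lemma dotNl u v : dot (- u) v = - dot u v.
Proof. by rewrite -scaleN1r dotC dotZr mulN1r dotC. Qed.

Lemma dotNr u v : dot u (- v) = - dot u v.
Proof. by rewrite dotC dotNl dotC. Qed.

Lemma dot_delta u k : dot u (delta_mx k 0) = u k 0.
Proof.
rewrite dotE (bigD1 k) //= big1 ?addr0 => [|j jk]; rewrite mxE ?eqxx ?mulr1 //.
by rewrite (negPf jk) mulr0.
Qed.

Lemma sqr_coord_le_dot u k : u k 0 ^+ 2 <= dot u u.
Proof.
rewrite dotE (bigD1 k) //= expr2 lerDl sumr_ge0 // => j _.
by rewrite -expr2 sqr_ge0.
Qed.

Lemma dot_ge0 u : 0 <= dot u u.
Proof. by rewrite dotE sumr_ge0 // => j _; rewrite -expr2 sqr_ge0. Qed.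

Lemma dot_eq0 u : dot u u <= 0 -> u = 0.
Proof.
move=> u0; apply/matrixP => k j; rewrite ord1 mxE.
apply/eqP; rewrite -sqrf_eq0 eq_le sqr_ge0 andbT.
exact: le_trans (sqr_coord_le_dot _ _) u0.
Qed.

End Dot.

(* [0 <= sum (W s_i / w_i - S)^2 w_i], where [S = sum s] and [W = sum w]. *)
Lemma sqr_sum_le {R : realType} (I : finType) (s w b : I -> R) :
  (forall i, 0 < w i) -> (forall i, s i ^+ 2 <= w i * b i) ->
  (\sum_i s i) ^+ 2 <= (\sum_i w i) * \sum_i b i.
Proof.
move=> w0 sb; set S := \sum_i s i; set W := \sum_i w i.
have [i0 _|noI] := pickP I; last first.
  by rewrite /S /W !big_pred0 // expr0n mul0r.
have W0 : 0 < W.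
  rewrite /W (bigD1 i0) //= ltr_wpDr // sumr_ge0 // => i _; exact: ltW.
have : 0 <= \sum_i (W ^+ 2 * b i - 2 * W * S * s i + S ^+ 2 * w i).
  apply: sumr_ge0 => i _.
  have -> : W ^+ 2 * b i - 2 * W * S * s i + S ^+ 2 * w i =
     (W * s i - S * w i) ^+ 2 / w i + W ^+ 2 * (w i * b i - s i ^+ 2) / w i.
    by field; rewrite gt_eqF.
  rewrite -mulrDl divr_ge0 ?addr_ge0 ?sqr_ge0 ?(ltW (w0 i)) //.
  by rewrite ?mulr_ge0 ?sqr_ge0 ?(ltW W0) ?subr_ge0 ?sb.
rewrite big_split sumrB -!mulr_sumr -/S -/W /=.
rewrite (_ : _ + _ = W * (W * (\sum_i b i) - S ^+ 2)); last by ring.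
by rewrite pmulr_rge0 // subr_ge0.
Qed.

Lemma sqr_dot_ones {R : realType} m (y : 'cV[R]_m) :
  dot (ones m) y ^+ 2 <= m%:R * dot y y.
Proof.
have := @sqr_sum_le R 'I_m (fun k => y k 0) (fun=> 1) (fun k => y k 0 ^+ 2).
rewrite sumr_const card_ord !dotE => /(_ (fun=> ltr01)) le_sum.
under eq_bigr do rewrite mxE mul1r.
by apply: le_sum => i; rewrite mul1r.
Qed.

Lemma ones_mul {R : realType} m (y : 'cV[R]_m) :
  ones m *m (ones m)^T *m y = dot (ones m) y *: ones m.
Proof.
rewrite -mulmxA; apply/matrixP => j k.
rewrite (ord1 k) mxE big_ord1 [X in X * _]mxE mul1r [RHS]mxE [X in _ = _ * X]mxE.
by rewrite mulr1.
Qed.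

(** For [d > 0], multiply the bound by [d]. For [d = 0] the inverse is [+oo], the bound is void and
    the claim reads [0 < 1]. *)
Lemma ltNinve_gt0 {R : realType} (d r : R) :
  0 <= d -> (- (d%:E^-1) < r%:E)%E -> 0 < 1 + d * r.
Proof.
rewrite le0r => /orP[/eqP-> _|d0]; first by rewrite mul0r addr0.
rewrite inver gt_eqF // -EFinN lte_fin => dr.
rewrite -(ltr_pM2l d0) mulrN divff ?gt_eqF // in dr; lra.
Qed.

(** Complementarity leaves two cases: [y = 0] with [t <= u], or zero gradient with
    [d * y = t - u >= 0]. *)
Lemma scalar_kkt {R : realType} (d t u y : R) : 0 < d ->
  (0 <= y /\ 0 <= d * y + u - t /\ y * (d * y + u - t) = 0) <->
  y = d^-1 * Num.max (t - u) 0.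
Proof.
move=> d0; have dN0 : d != 0 by rewrite gt_eqF.
split=> [[y0 [g0 /eqP]]|->].
  rewrite mulf_eq0 => /orP[/eqP y_0|/eqP g_0].
    by rewrite y_0 in g0 *; rewrite max_r ?mulr0 //; lra.
  have -> : t - u = d * y by lra.
  by rewrite max_l ?mulKf // mulr_ge0 // ltW.
rewrite mulVKf //; have [tu|/ltW tu] := lerP (t - u) 0.
  by rewrite mulr0 mul0r lexx; split=> //; split=> //; lra.
rewrite mulr_ge0 ?invr_ge0 ?(ltW d0) // (_ : _ + u - t = 0) ?mulr0 //; lra.
Qed.

Lemma kkt_grad_ge0 {R : realType} m (g y z : 'cV[R]_m) :
  (forall k, 0 <= g k 0 /\ y k 0 * g k 0 = 0) -> feasible z -> 0 <= dot g (z - y).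
Proof.
move=> kkt z0; rewrite dotE sumr_ge0 // => k _; have [g0 yg] := kkt k.
by rewrite !mxE mulrBr [_ * y k 0]mulrC yg subr0 mulr_ge0.
Qed.

(** * Strongly convex quadratic programs on the nonnegative orthant *)

Section QuadraticProgram.
Context {R : realType} (m : nat) (Q : 'M[R]_m) (c : 'cV[R]_m) (mu : R).
Hypothesis Qsym : Q^T = Q.
Hypothesis mu_gt0 : 0 < mu.
Hypothesis Qmu : forall x, mu * dot x x <= dot x (Q *m x).
Implicit Types x y z : 'cV[R]_m.

Lemma quad_objE y : quad_obj Q c y = 2^-1 * dot y (Q *m y) - dot c y.
Proof. by rewrite /quad_obj /dot mulmxA. Qed.

Lemma dot_symmx x y : dot x (Q *m y) = dot y (Q *m x).
Proof. by rewrite dotC /dot trmx_mul Qsym mulmxA. Qed.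

Lemma quad_objD y h :
  quad_obj Q c (y + h) =
  quad_obj Q c y + dot (Q *m y - c) h + 2^-1 * dot h (Q *m h).
Proof.
rewrite !quad_objE mulmxDr !dotDl !dotDr dotNl (dot_symmx y h) (dotC (Q *m y)).
by field.
Qed.

(** Sufficiency follows from the exact expansion [quad_objD]; necessity from moving a single
    coordinate of the minimiser. *)
Lemma qp_kkt y : qp_solution Q c y <->
  feasible y /\ forall k, 0 <= (Q *m y - c) k 0 /\ y k 0 * (Q *m y - c) k 0 = 0.
Proof.
set g := Q *m y - c; split => [[y0 ymin]|[y0 kkt]]; last first.
  split=> // z z0; rewrite -(subrKC y z) quad_objD -/g -addrA lerDl.
  rewrite addr_ge0 ?mulr_ge0 ?invr_ge0 //; last first.
    by apply: le_trans (Qmu _); rewrite mulr_ge0 ?dot_ge0 ?ltW.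
  by apply: kkt_grad_ge0 => //; exact: z0.
split=> // k; set e : 'cV[R]_m := delta_mx k 0.
have step t : 0 <= y k 0 + t -> 0 <= t * g k 0 + 2^-1 * t ^+ 2 * dot e (Q *m e).
  move=> yt; have /ymin : feasible (y + t *: e).
    move=> j; rewrite !mxE; have [->|_] := eqVneq j k; first by rewrite mulr1.
    by rewrite mulr0 addr0.
  rewrite quad_objD -/g -addrA lerDl -scalemxAr !dotZr dot_delta.
  by rewrite (dotC (t *: e)) dotZr dotC expr2 !mulrA.
set q := dot e (Q *m e) in step *.
have q0 : 0 < q.
  apply: lt_le_trans (Qmu e); rewrite mulr_gt0 //.
  by rewrite dot_delta mxE !eqxx.
have g0 : 0 <= g k 0.
  (* The minimiser [- g / q] of the one-variable quadratic would lower the objective by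
     [g^2 / (2 q)]. *)
  rewrite leNgt; apply/negP => gneg; have := step (- g k 0 / q).
  have gq : 0 < - g k 0 / q by rewrite divr_gt0 // oppr_gt0.
  rewrite addr_ge0 ?(ltW gq) // => /(_ isT).
  rewrite (_ : _ + _ = - (2^-1 * (g k 0 ^+ 2 / q))); last first.
    by field; rewrite gt_eqF.
  have g2 : 0 < g k 0 ^+ 2 / q by rewrite divr_gt0 // exprn_even_gt0 //= lt_eqF.
  by rewrite oppr_ge0 leNgt mulr_gt0 // invr_gt0.
split=> //; apply/eqP; rewrite mulf_eq0 -implyNb; apply/implyP => ynz.
have ypos : 0 < y k 0 by rewrite lt_def ynz y0.
rewrite eq_le g0 andbT leNgt; apply/negP => gpos.
(* A step back by [t] stays feasible by the first cap; the second keeps the linear gain above the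
   quadratic loss. *)
pose t := Num.min (y k 0) (g k 0 / q).
have t0 : 0 < t by rewrite lt_min ypos divr_gt0.
have ty : t <= y k 0 by rewrite ge_min lexx.
have tg : t * q <= g k 0 by rewrite -ler_pdivlMr // ge_min lexx orbT.
have := step (- t); rewrite subr_ge0 ty => /(_ isT).
rewrite (_ : _ + _ = - (t * (g k 0 - t * q) + 2^-1 * (t * (t * q)))); last first.
  by field.
rewrite oppr_ge0 leNgt ltr_wpDl // ?mulr_gt0 ?invr_gt0 //.
by rewrite mulr_ge0 ?subr_ge0 // ltW.
Qed.

(** The gradient term at [y] is nonnegative towards [z], so [z] exceeds the minimum by at least
    [mu / 2] times the squared distance. *)
Lemma qp_unique y z : qp_solution Q c y -> qp_solution Q c z -> y = z.
Proof.
move=> ys zs; have [y0 ykkt] := (qp_kkt y).1 ys; have [z0 _] := zs.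
apply/eqP; rewrite eq_sym -subr_eq0; apply/eqP/dot_eq0.
have [_ /(_ y y0)] := zs; rewrite -{1}(subrKC y z) quad_objD => zy.
have gz : 0 <= dot (Q *m y - c) (z - y) by exact: kkt_grad_ge0.
have := Qmu (z - y); rewrite -(pmulr_rle0 _ mu_gt0); lra.
Qed.

(** Row vectors are used to match [EVT_min_rV]. *)
Lemma quad_obj_continuous : continuous (fun v : 'rV[R]_m => quad_obj Q c v^T).
Proof.
have -> : (fun v : 'rV[R]_m => quad_obj Q c v^T) = (fun v =>
    2^-1 * (\sum_i v 0 i * \sum_j Q i j * v 0 j) - \sum_i c i 0 * v 0 i).
  apply/funext => v; rewrite quad_objE !dotE; congr (_ * _ - _).
    by apply: eq_bigr => i _; rewrite !mxE; congr (_ * _);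
      apply: eq_bigr => j _; rewrite mxE.
  by apply: eq_bigr => i _; rewrite mxE.
have sumc (F : 'I_m -> 'rV[R]_m -> R) : (forall i, continuous (F i)) ->
    continuous (fun v => \sum_i F i v).
  by move=> Fc; apply: continuous_big => [|i _]; [exact: add_continuous|exact: Fc].
have coordc := @coord_continuous R 1 m 0.
have cstM (a : R) (f : 'rV[R]_m -> R) : continuous f -> continuous (fun v => a * f v).
  by move=> fc v; exact: cvgM (cvg_cst a) (fc v).
have cQ : continuous (fun v : 'rV[R]_m =>
    2^-1 * \sum_i v 0 i * \sum_j Q i j * v 0 j).
  apply/cstM/sumc => i.
  have ci : continuous (fun v : 'rV[R]_m => \sum_j Q i j * v 0 j).
    by apply: sumc => j; apply: cstM; exact: coordc.
  by move=> v; exact: cvgM (coordc i v) (ci v).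
have cc : continuous (fun v : 'rV[R]_m => \sum_i c i 0 * v 0 i).
  by apply: sumc => i; apply: cstM; exact: coordc.
by move=> v; exact: cvgB (cQ v) (cc v).
Qed.

(** Feasible points of nonpositive objective lie in a compact box, and all others are no better than
    [0], which is in the box. *)
Lemma qp_exists : exists y, qp_solution Q c y.
Proof.
(* Nonpositive objective gives [mu |z|^2 <= 2 c.z]; with [|mu z - 2 c|^2 >= 0] this yields
   [|z|^2 <= M - 1]. As [M >= 1], each coordinate is then at most [M]. *)
pose M := (2 / mu) ^+ 2 * dot c c + 1.
have M1 : 1 <= M by rewrite lerDr mulr_ge0 ?sqr_ge0 ?dot_ge0.
have box z k : quad_obj Q c z <= 0 -> z k 0 <= M.
  rewrite quad_objE => qz; have := Qmu z.
  have := dot_ge0 (mu *: z - 2 *: c).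
  rewrite !(dotDl, dotDr, dotNl, dotNr, dotZr) !(dotC (_ *: _)) !dotZr (dotC z c).
  move=> sq muz.
  have : mu * (mu * dot z z) <= mu * (2 * dot c z) by rewrite ler_pM2l //; lra.
  move=> muz'; have zz : dot z z <= (2 / mu) ^+ 2 * dot c c.
    rewrite (_ : _ * _ = 4 * dot c c / mu ^+ 2); last by field; rewrite gt_eqF.
    by rewrite ler_pdivlMr ?exprn_gt0 //; nra.
  have := le_trans (sqr_coord_le_dot z k) zz => zk.
  rewrite leNgt; apply/negP; rewrite /M; nra.
pose A := [set v : 'rV[R]_m | forall i, `[0, M]%classic (v ord0 i)]%classic.
have A0 : A 0 by move=> i /=; rewrite mxE in_itv /= lexx; lra.
have cA : compact A := rV_compact (fun=> @segment_compact R 0 M).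
have [v vA vmin] := EVT_min_rV (ex_intro _ _ A0) cA
  (continuous_subspaceT quad_obj_continuous).
exists v^T; split.
  move=> k; move: vA; rewrite inE => /(_ k) /=; rewrite in_itv /= mxE.
  by case/andP.
have obj0 : quad_obj Q c 0 = 0.
  by rewrite quad_objE mulmx0 /dot !mulmx0 mxE mulr0 subr0.
move=> z z0; have [zle0|/ltW zgt0] := lerP (quad_obj Q c z) 0; last first.
  apply: le_trans zgt0; have := vmin 0; rewrite trmx0 obj0; apply.
  by rewrite inE.
rewrite -(trmxK z); apply: vmin; rewrite inE => k /=.
by rewrite mxE in_itv /= z0 box.
Qed.

End QuadraticProgram.

(** * Block decomposition of vectors *)

Section Blocks.
Context {R : realType} (K : nat) (n_ : 'I_K -> nat).

Lemma dot_mxcol (x y : 'cV[R]_(\sum_i n_ i)) :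
  dot x y = \sum_i dot (submxcol x i) (submxcol y i).
Proof.
by rewrite -{1}(submxcolK x) -{1}(submxcolK y) /dot tr_mxcol mul_mxrow_mxcol summxE.
Qed.

Lemma submxcolZ (a : R) (B : 'cV[R]_(\sum_i n_ i)) i :
  submxcol (a *: B) i = a *: submxcol B i.
Proof. by apply/matrixP => j k; rewrite !mxE. Qed.

Lemma submxcol_ones i : submxcol (ones (\sum_i n_ i)) i = ones (n_ i) :> 'cV[R]__.
Proof. by apply/matrixP => j k; rewrite !mxE. Qed.

Lemma dot_ones (y : 'cV[R]_(\sum_i n_ i)) :
  dot (ones _) y = \sum_i dot (ones _) (submxcol y i).
Proof. by rewrite dot_mxcol; apply: eq_bigr => i _; rewrite submxcol_ones. Qed.

End Blocks.

(** * Coercivity of the block correlation matrix *)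

Section BlockCorrelation.
Context {R : realType} (K : nat) (n_ : 'I_K -> nat).
Variables (rho_ : 'I_K -> R) (rho : R).
Hypothesis K_gt0 : (0 < K)%N.
Hypothesis n_gt0 : forall i, (0 < n_ i)%N.
Hypothesis rho_iP : rho_block_range n_ rho_.
Hypothesis rhoP : rho_range n_ rho_ rho.

Local Notation Omega := (block_corr n_ rho_ rho).

Lemma block_corr_mul (y : 'cV[R]_(\sum_i n_ i)) i :
  submxcol (Omega *m y) i =
  ((1 - rho) * (1 - rho_ i)) *: submxcol y i +
  ((1 - rho) * (rho_ i * dot (ones _) (submxcol y i)) +
   rho * \sum_j dot (ones _) (submxcol y j)) *: ones (n_ i).
Proof.
rewrite mulmxDl -!scalemxAl ones_mul -{1}(submxcolK y) mul_mxdiag_mxcol.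
rewrite submxcolD !submxcolZ mxcolK submxcol_ones dot_ones.
rewrite /unit_corr mulmxDl -!scalemxAl mul1mx ones_mul.
by rewrite scalerDr !scalerA scalerDl addrA mulrA.
Qed.

(* The eigenvalue of [unit_corr (n_ i) (rho_ i)] on the vector of ones. *)
Let ones_eig i := 1 + ((n_ i)%:R - 1) * rho_ i.
Let N := \sum_i (n_ i)%:R / ones_eig i.
Let B (x : 'cV[R]_(\sum_i n_ i)) i :=
  (1 - rho_ i) * dot (submxcol x i) (submxcol x i) +
  rho_ i * dot (ones _) (submxcol x i) ^+ 2.

Lemma subr_rho_i_gt0 i : 0 < 1 - rho_ i.
Proof. by rewrite subr_gt0; have [] := rho_iP i. Qed.

Lemma subr_rho_gt0 : 0 < 1 - rho.
Proof. by rewrite subr_gt0; case: rhoP. Qed.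

Lemma nB1_ge0 i : 0 <= (n_ i)%:R - 1 :> R.
Proof. by rewrite subr_ge0 ler1n. Qed.

Lemma ones_eig_gt0 i : 0 < ones_eig i.
Proof. by have [ri _] := rho_iP i; exact: ltNinve_gt0 (nB1_ge0 i) ri. Qed.

(** The lower bound on [rho] gives this once [N >= 1]: there is a block, and each summand is at
    least 1 since [n_i - ones_eig i = (n_i - 1) (1 - rho_i)]. *)
Lemma rhoN_gt0 : 0 < 1 + (N - 1) * rho.
Proof.
have [r0 _] := rhoP; apply: ltNinve_gt0 r0; rewrite subr_ge0.
have Nge1 i : 1 <= (n_ i)%:R / ones_eig i.
  rewrite ler_pdivlMr ?ones_eig_gt0 // mul1r /ones_eig.
  have := mulr_ge0 (nB1_ge0 i) (ltW (subr_rho_i_gt0 i)); lra.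
rewrite (bigD1 (Ordinal K_gt0)) //= (le_trans (Nge1 (Ordinal K_gt0))) // lerDl.
by apply: sumr_ge0 => i _; exact: le_trans ler01 (Nge1 i).
Qed.

Lemma block_corr_quad x :
  dot x (Omega *m x) =
  (1 - rho) * (\sum_i B x i) + rho * (\sum_i dot (ones _) (submxcol x i)) ^+ 2.
Proof.
rewrite dot_mxcol expr2 mulr_sumr mulrA mulr_sumr -big_split /=.
apply: eq_bigr => i _; rewrite block_corr_mul dotDr !dotZr.
rewrite (dotC (submxcol x i) (ones _)) /B; ring.
Qed.

(** For [rho_i >= 0] the square of the block sum is dropped; otherwise Cauchy-Schwarz bounds it by
    [n_i] times the squared norm. *)
Lemma block_quad_ge x i :
  Num.min (1 - rho_ i) (ones_eig i) * dot (submxcol x i) (submxcol x i) <= B x i.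
Proof.
have := sqr_dot_ones (submxcol x i); rewrite /B /ones_eig.
set s := dot (ones _) _; set d := dot _ _ => sd.
have d0 : 0 <= d by exact: dot_ge0.
have [r0|/ltW r0] := lerP 0 (rho_ i).
  apply: (@le_trans _ _ ((1 - rho_ i) * d)).
    by rewrite ler_wpM2r // ge_min lexx.
  by rewrite lerDl mulr_ge0 // sqr_ge0.
apply: (@le_trans _ _ ((1 + ((n_ i)%:R - 1) * rho_ i) * d)).
  by rewrite ler_wpM2r // ge_min lexx orbT.
have := ler_wnM2l r0 sd; lra.
Qed.

(** After clearing the denominator, the two sides differ by [1 - rho_i] times the Cauchy-Schwarz
    gap. *)
Lemma block_sum_sqr_le x i :
  dot (ones _) (submxcol x i) ^+ 2 <= (n_ i)%:R / ones_eig i * B x i.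
Proof.
have := sqr_dot_ones (submxcol x i).
rewrite mulrAC ler_pdivlMr ?ones_eig_gt0 // /B /ones_eig.
move/(ler_wpM2l (ltW (subr_rho_i_gt0 i))); lra.
Qed.

Lemma block_corr_coercive :
  exists2 mu, 0 < mu & forall x, mu * dot x x <= dot x (Omega *m x).
Proof.
pose kappa := \big[Num.min/1]_i Num.min (1 - rho_ i) (ones_eig i).
have kappa0 : 0 < kappa.
  apply: lt_bigmin => [|i _]; first exact: ltr01.
  by rewrite lt_min subr_rho_i_gt0 ones_eig_gt0.
(* The two entries serve [rho >= 0], where the square is dropped, and [rho <= 0], where it is
   bounded by [N * sum B]. *)
pose nu := Num.min (1 - rho) (1 + (N - 1) * rho).
have nu0 : 0 < nu by rewrite lt_min subr_rho_gt0 rhoN_gt0.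
exists (nu * kappa) => [|x]; first by rewrite mulr_gt0.
have kB : kappa * dot x x <= \sum_i B x i.
  rewrite dot_mxcol mulr_sumr; apply: ler_sum => i _.
  apply: le_trans (block_quad_ge x i); rewrite ler_wpM2r ?dot_ge0 //.
  exact: bigmin_le.
have SB : (\sum_i dot (ones _) (submxcol x i)) ^+ 2 <= N * \sum_i B x i.
  apply: sqr_sum_le (block_sum_sqr_le x) => i.
  by rewrite divr_gt0 ?ones_eig_gt0 // ltr0n.
rewrite -mulrA (le_trans (ler_wpM2l (ltW nu0) kB)) // block_corr_quad.
have B0 : 0 <= \sum_i B x i by apply: le_trans kB; rewrite mulr_ge0 ?dot_ge0 ?ltW.
have [r0|/ltW r0] := lerP 0 rho.
  apply: (@le_trans _ _ ((1 - rho) * \sum_i B x i)).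
    by rewrite ler_wpM2r // ge_min lexx.
  by rewrite lerDl mulr_ge0 // sqr_ge0.
apply: (@le_trans _ _ ((1 + (N - 1) * rho) * \sum_i B x i)).
  by rewrite ler_wpM2r // ge_min lexx orbT.
have := ler_wnM2l r0 SB; lra.
Qed.

Lemma block_corr_sym : Omega^T = Omega.
Proof.
rewrite /block_corr linearD !linearZ /= tr_mxdiag trmx_mul trmxK.
congr (_ *: _ + _); apply: eq_mxdiag => i.
by rewrite /unit_corr linearD !linearZ /= trmx1 trmx_mul trmxK.
Qed.

(** * Thresholds and optimality conditions *)

Variable theta : 'cV[R]_(\sum_i n_ i).

Definition hat_of (y : 'cV[R]_(\sum_i n_ i)) : R :=
  rho * \sum_j dot (ones _) (submxcol y j).

Definition bar_of (y : 'cV[R]_(\sum_i n_ i)) : 'cV[R]_K :=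
  \col_i ((1 - rho) * (rho_ i * dot (ones _) (submxcol y i))).

Definition thresholded (hat_t : R) (bar_t : 'cV[R]_K) : 'cV[R]_(\sum_i n_ i) :=
  \mxcol_i (((1 - rho) * (1 - rho_ i))^-1 *: excess theta hat_t bar_t i).

Lemma block_kkt y :
  qp_solution Omega theta y <-> y = thresholded (hat_of y) (bar_of y).
Proof.
have [mu mu0 Omu] := block_corr_coercive.
rewrite (qp_kkt _ block_corr_sym mu0 Omu).
(* Flat coordinates are matched with pairs (block, position) so that [scalar_kkt] applies to
   each. *)
have E i j : y (tagnat.Rank i j) 0 = submxcol y i j 0 by rewrite mxE.
have d0 i : 0 < (1 - rho) * (1 - rho_ i) by rewrite mulr_gt0 ?subr_rho_gt0 ?subr_rho_i_gt0.
have key i j : (0 <= submxcol y i j 0 /\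
    0 <= submxcol (Omega *m y - theta) i j 0 /\
    submxcol y i j 0 * submxcol (Omega *m y - theta) i j 0 = 0) <->
    submxcol y i j 0 = submxcol (thresholded (hat_of y) (bar_of y)) i j 0.
  rewrite /thresholded mxcolK submxcolB block_corr_mul !mxE !mulr1.
  by rewrite (addrC (hat_of y)); exact: scalar_kkt.
split=> [[y0 kkt]|yE].
  apply/mxcolP => i; apply/matrixP => j k; rewrite (ord1 k); apply/key.
  by rewrite -E y0 [submxcol _ i j 0]mxE; split=> //; exact: kkt.
have kkt k : 0 <= y k 0 /\ 0 <= (Omega *m y - theta) k 0 /\
    y k 0 * (Omega *m y - theta) k 0 = 0.
  have := (key (tagnat.sig1 k) (tagnat.sig2 k)).2.
  rewrite -yE => /(_ erefl).
  by rewrite [submxcol y _ _ _]mxE [submxcol _ _ _ _]mxE tagnat.sig2K.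
by split=> k; have [? ?] := kkt k.
Qed.

(** Block sums of the thresholded vector are the total excesses over [(1 - rho) (1 - rho_i)]; the
    factors then cancel. *)
Lemma threshold_fixpointP hat_t bar_t :
  threshold_fixpoint rho_ rho theta hat_t bar_t <->
  hat_of (thresholded hat_t bar_t) = hat_t /\
  bar_of (thresholded hat_t bar_t) = bar_t.
Proof.
have sE i : dot (ones _) (submxcol (thresholded hat_t bar_t) i) =
    ((1 - rho) * (1 - rho_ i))^-1 * total_excess theta hat_t bar_t i.
  by rewrite mxcolK dotZr.
have barE i : bar_of (thresholded hat_t bar_t) i 0 =
    rho_ i / (1 - rho_ i) * total_excess theta hat_t bar_t i.
  by rewrite mxE sE; field; rewrite !gt_eqF ?subr_rho_gt0 ?subr_rho_i_gt0.
have hatE : hat_of (thresholded hat_t bar_t) = rho / (1 - rho) *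
    \sum_j (1 - rho_ j)^-1 * total_excess theta hat_t bar_t j.
  rewrite /hat_of -mulrA [in RHS]mulr_sumr; congr (_ * _).
  by apply: eq_bigr => i _; rewrite sE invfM mulrA.
split=> [[bE hE]|[hE bE]].
  split; first by rewrite hatE -hE.
  by apply/matrixP => i j; rewrite (ord1 j) barE -bE.
by split=> [i|]; [rewrite -barE bE|rewrite -hatE hE].
Qed.

End BlockCorrelation.

Theorem proposition2 (R : realType) (K : nat) (n_ : 'I_K -> nat)
    (rho_ : 'I_K -> R) (rho : R) (theta : 'cV[R]_(\sum_i n_ i))
    (K_gt0 : (0 < K)%N) (n_gt0 : forall i, (0 < n_ i)%N)
    (theta_gt0 : forall k, 0 < theta k 0)
    (rho_iP : rho_block_range n_ rho_) (rhoP : rho_range n_ rho_ rho) :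
  (exists! y, qp_solution (block_corr n_ rho_ rho) theta y) /\
  (exists! t : R * 'cV[R]_K, threshold_fixpoint rho_ rho theta t.1 t.2) /\
  (forall (y : 'cV[R]_(\sum_i n_ i)) (hat_t : R) (bar_t : 'cV[R]_K),
     qp_solution (block_corr n_ rho_ rho) theta y ->
     threshold_fixpoint rho_ rho theta hat_t bar_t ->
     forall i : 'I_K,
       submxcol y i = ((1 - rho) * (1 - rho_ i))^-1 *:
         pospart (submxcol theta i - (hat_t + bar_t i 0) *: ones (n_ i))).
Proof.
have block_kkt := block_kkt K_gt0 n_gt0 rho_iP rhoP theta.
have fixP := threshold_fixpointP rho_iP rhoP theta.
have [mu mu0 Omu] := block_corr_coercive K_gt0 n_gt0 rho_iP rhoP.
have Osym := block_corr_sym n_ rho_ rho.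
have uniq := qp_unique Osym mu0 Omu.
have [y ys] := qp_exists theta mu0 Omu.
have fix_sol h b : threshold_fixpoint rho_ rho theta h b ->
    qp_solution (block_corr n_ rho_ rho) theta (thresholded rho_ rho theta h b).
  by move=> /fixP[hE bE]; apply/block_kkt; rewrite hE bE.
split; first by exists y; split=> // z; exact: uniq.
split; last first.
  by move=> z h b zs /fix_sol ts i; rewrite (uniq _ _ _ zs ts) mxcolK.
have yE := (block_kkt y).1 ys.
exists (hat_of rho y, bar_of rho_ rho y); split=> [|[h b] /= hb].
  by apply/fixP; rewrite /= -yE.
(* Any fixed point thresholds [theta] to the unique solution [y], from which [hat_of] and [bar_of]
   recover it. *)
by rewrite (uniq _ _ _ ys (fix_sol _ _ hb)); have [-> ->] := (fixP h b).1 hb.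
Qed.
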